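(* Let $R$ be a perfect $\mathbb F_p$-algebra, where $p$ is a prime, and let $Q$ be an $R$-module (not necessarily finitely generated and not necessarily projective) of finite projective dimension over $R$. Then $\mathrm{p.dim}_{W(R)}(Q)=\mathrm{p.dim}_R(Q)+1$.
   Context: An $\mathbb F_p$-algebra is perfect if its Frobenius map $x\mapsto x^p$ is an isomorphism. $W(R)$ denotes the ring of ($p$-typical) Witt vectors of $R$, with $W(R)/pW(R)\simeq R$; $Q$ is viewed as a $W(R)$-module through the surjection $W(R)\to R$. $\mathrm{p.dim}$ denotes projective dimension. *)

(* Defs.v *)
From HB Require Import structures.
From mathcomp Require Import all_boot all_order all_algebra finmap.
From mathcomp.multinomials Require Import monalg.
From mathcomp Require boolp.
From mathcomp Require Import constructive_ereal.

Set Implicit Arguments.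
Unset Strict Implicit.
Unset Printing Implicit Defensive.

Import Order.TTheory GRing.Theory Num.Theory.
Local Open Scope ring_scope.

(* Packaging this as a comPzRingType keeps unification from unfolding malg. *)
Definition ipoly (I : choiceType) : comPzRingType := {malg int[{cmonom I}]}.

Definition var (I : choiceType) (i : I) : ipoly I := mkmalgU (ucm i) 1.

(* The library's mmap only targets nonzero rings; the zero ring is a legitimate
   coefficient ring here. *)
Section Evaluation.
Variables (I : choiceType) (R : comPzRingType) (f : I -> R).

Definition mono_eval (m : {cmonom I}) : R :=
  \prod_(i <- finsupp m) f i ^+ m i.

Definition peval (g : ipoly I) : R :=
  \sum_(m <- msupp g) (g@_m)%:~R * mono_eval m.

Lemma mono_evalEw (d : {fset I}) (m : {cmonom I}) :
  (finsupp m `<=` d)%fset -> mono_eval m = \prod_(i <- d) f i ^+ m i.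
Proof.
move=> le; apply: big_fset_incl => // i _; rewrite -cmE_eq0 => /eqP ->.
by rewrite expr0.
Qed.

Lemma mono_eval1 : mono_eval (onecm I) = 1.
Proof.
by rewrite (mono_evalEw (d := fset0)) ?big_seq_fset0 //; rewrite (@mdom1 I).
Qed.

Lemma mono_evalM m1 m2 :
  mono_eval (mulcm m1 m2) = mono_eval m1 * mono_eval m2.
Proof.
have /= E := @mdomD I m1 m2.
rewrite (mono_evalEw (d := (finsupp m1 `|` finsupp m2)%fset)); last first.
  by rewrite -E.
rewrite (mono_evalEw (m := m1) (fsubsetUl _ (finsupp m2))).
rewrite (mono_evalEw (m := m2) (fsubsetUr (finsupp m1) _)) -big_split /=.
by apply: eq_bigr => i _; rewrite mulcmE exprD.
Qed.

Lemma pevalEw (d : {fset {cmonom I}}) (g : ipoly I) :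
  (msupp g `<=` d)%fset ->
  peval g = \sum_(m <- d) (g@_m)%:~R * mono_eval m.
Proof.
move=> le; apply: big_fset_incl => // m _ /mcoeff_outdom ->.
by rewrite mulr0z mul0r.
Qed.

Lemma pevalU c m : peval << c *g m >> = c%:~R * mono_eval m.
Proof. by rewrite (pevalEw msuppU_le) big_seq_fset1 mcoeffUU. Qed.

Lemma peval_is_zmod_morphism : zmod_morphism peval.
Proof.
move=> g1 g2 /=; set d := (msupp g1 `|` msupp g2)%fset.
rewrite (pevalEw (d := d) (msuppB_le _ _)).
rewrite (pevalEw (g := g1) (fsubsetUl _ (msupp g2))).
rewrite (pevalEw (g := g2) (fsubsetUr (msupp g1) _)) -sumrB /=.
by apply: eq_bigr => m _; rewrite mcoeffB rmorphB mulrBl.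
Qed.

HB.instance Definition _ :=
  GRing.isZmodMorphism.Build (ipoly I) R peval peval_is_zmod_morphism.

Lemma peval_is_monoid_morphism : monoid_morphism peval.
Proof.
split=> [|g1 g2]; first by rewrite [1]/(<< _ *g _ >>) pevalU mono_eval1 mulr1.
rewrite malgME raddf_sum /= {2 3}/peval mulr_suml; apply: eq_bigr => m1 _.
rewrite raddf_sum mulr_sumr; apply: eq_bigr => m2 _ /=.
by rewrite pevalU mono_evalM rmorphM mulrACA.
Qed.

HB.instance Definition _ :=
  GRing.isMonoidMorphism.Build (ipoly I) R peval peval_is_monoid_morphism.

Lemma peval_var i : peval (var i) = f i.
Proof.
rewrite pevalU mul1r /mono_eval (@mdomU I i) big_seq_fset1.
by rewrite ucmE eqxx expr1.
Qed.

End Evaluation.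

Lemma peval_comp (I : choiceType) (R S : comPzRingType) (h : {rmorphism R -> S})
  (f : I -> R) (g : ipoly I) : h (peval f g) = peval (h \o f) g.
Proof.
rewrite /peval raddf_sum; apply: eq_bigr => m _ /=.
rewrite rmorphM rmorph_int rmorph_prod; congr (_ * _).
by apply: eq_bigr => i _; rewrite rmorphXn.
Qed.

Lemma var_mulU (I : choiceType) (i : I) (m : {cmonom I}) :
  var i * mkmalgU m 1 = mkmalgU (mulcm (ucm i) m) 1.
Proof. by rewrite malgM_def fgmulUU mulr1. Qed.

Lemma ipoly_ind (I : choiceType) (P : ipoly I -> Prop) :
  P 1 -> (forall i, P (var i)) -> (forall a b, P a -> P b -> P (a - b)) ->
  (forall a b, P a -> P b -> P (a * b)) -> forall g, P g.
Proof.
move=> P1 PX PB PM.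
have P0 : P 0 by rewrite -(subrr 1); apply: PB.
have PN a : P a -> P (- a) by move=> Pa; rewrite -sub0r; apply: PB.
have PD a b : P a -> P b -> P (a + b).
  by move=> Pa Pb; rewrite -[b]opprK; apply/PB => //; apply: PN.
have Pm n : forall m : {cmonom I}, mdeg m = n -> P << m >>.
  elim: n => [|n IH] m dm; first by rewrite (mdeg_eq0I dm).
  have [i mi] : exists i, m i != 0%N.
    case: (fset_0Vmem (finsupp m)) => [E|[i im]].
      by move: dm; rewrite mdegE [finsupp m]E big_seq_fset0.
    by exists i; rewrite (@cmE_neq0 I).
  have E : m = mulcm (ucm i) (divcm m (ucm i)).
    apply/eqP/cmP => j; rewrite mulcmE divcmE ucmE.
    by case: eqVneq => [<-|_]; rewrite ?add0n ?subn0 // subnKC // lt0n.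
  have dm' : mdeg (divcm m (ucm i)) = n.
    by move: dm; rewrite {1}E mdegM mdegU => -[].
  rewrite E.
  rewrite -var_mulU.
  exact: PM (PX i) (IH _ dm').
have Pn n a : P a -> P (a *+ n).
  by move=> Pa; elim: n => [|n IH]; rewrite ?mulr0n // mulrS; apply: PD.
have PU (c : int) m : P (mkmalgU m c).
  rewrite -[c]intz (raddfMz (mkmalgU m : {additive int -> ipoly I})).
  by case: c => n; [|apply: (PN)]; apply: (Pn); apply: (Pm _ m erefl).
move=> g; rewrite [g]monalgE.
exact: (big_ind P P0 PD (fun m _ => PU _ m)).
Qed.

Lemma ipoly_torsion_free (I : choiceType) (g : ipoly I) n :
  (0 < n)%N -> g *+ n = 0 -> g = 0.
Proof.
move=> n0 E; apply/malgP => m; have /malgP/(_ m) := E.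
rewrite mcoeffMn mcoeff0 => /eqP; rewrite mulrn_eq0 => /orP[/eqP n00|/eqP //].
by rewrite n00 in n0.
Qed.

Definition cong (A : comPzRingType) (m : nat) (a b : A) :=
  exists c, a = b + c *+ m.

Section Congruence.
Variables (A : comPzRingType) (m : nat).
Implicit Types a b c d : A.

Lemma cong_refl a : cong m a a.
Proof. by exists 0; rewrite mul0rn addr0. Qed.

Lemma cong_trans a b c : cong m a b -> cong m b c -> cong m a c.
Proof. by move=> [x ->] [y ->]; exists (y + x); rewrite mulrnDl addrA. Qed.

Lemma cong_sym a b : cong m a b -> cong m b a.
Proof. by move=> [x ->]; exists (- x); rewrite mulNrn addrK. Qed.

Lemma congB a b c d : cong m a b -> cong m c d -> cong m (a - c) (b - d).
Proof.
by move=> [x ->] [y ->]; exists (x - y); rewrite mulrnBl opprD addrACA.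
Qed.

Lemma congD a b c d : cong m a b -> cong m c d -> cong m (a + c) (b + d).
Proof.
by move=> [x ->] [y ->]; exists (x + y); rewrite mulrnDl addrACA.
Qed.

Lemma congM a b c d : cong m a b -> cong m c d -> cong m (a * c) (b * d).
Proof.
move=> ab [y ->]; apply: (@cong_trans _ (b * (d + y *+ m))).
  by case: ab => x ->; exists (x * (d + y *+ m)); rewrite mulrDl mulrnAl.
by exists (b * y); rewrite mulrDr mulrnAr.
Qed.

Lemma congX a b n : cong m a b -> cong m (a ^+ n) (b ^+ n).
Proof.
move=> ab; elim: n => [|n IH]; first exact: cong_refl.
by rewrite !exprS; apply: congM.
Qed.

Lemma cong_sum n (F G : nat -> A) :
  (forall i, (i < n)%N -> cong m (F i) (G i)) ->
  cong m (\sum_(i < n) F i) (\sum_(i < n) G i).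
Proof.
elim: n => [|n IH] FG; first by rewrite !big_ord0; apply: cong_refl.
rewrite !big_ord_recr /=; apply: congD; last exact: FG.
by apply: IH => i lt; apply: FG; rewrite ltnS ltnW.
Qed.

End Congruence.

Lemma cong_mulrn (A : comPzRingType) m n (a b : A) :
  cong m a b -> cong (m * n) (a *+ n) (b *+ n).
Proof. by move=> [x ->]; exists x; rewrite mulrnDl mulrnA. Qed.

Lemma cong_expp (A : comPzRingType) p k (a b : A) :
  cong (p ^ k.+1) a b -> cong (p ^ k.+2) (a ^+ p) (b ^+ p).
Proof.
move=> ab; have abp : cong p a b.
  by case: ab => x ->; exists (x *+ p ^ k); rewrite -mulrnA -expnSr.
case: p => [|p] in ab abp *; first by rewrite !expr0; apply: cong_refl.
have [y Ey] : cong p.+1 (\sum_(i < p.+1) a ^+ (p - i) * b ^+ i) 0.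
  have : cong p.+1 (\sum_(i < p.+1) a ^+ (p - i) * b ^+ i)
                   (\sum_(i < p.+1) b ^+ p).
    apply: (cong_sum (F := fun i => a ^+ (p - i) * b ^+ i)
                     (G := fun=> b ^+ p)).
    move=> i; rewrite ltnS => le.
    rewrite -[X in cong _ _ (b ^+ X)](subnK le) exprD.
    apply: congM; last exact: cong_refl.
    exact: congX.
  move=> /cong_trans; apply; exists (b ^+ p).
  by rewrite sumr_const card_ord add0r.
case: ab => x /eqP; rewrite addrC -subr_eq => /eqP Ex.
exists (x * y); apply/eqP; rewrite addrC -subr_eq subrXX Ex Ey add0r.
by rewrite mulrnAl mulrnAr -mulrnA -expnS.
Qed.

Lemma cong_exppX (A : comPzRingType) p k (a b : A) :
  cong p a b -> cong (p ^ k.+1) (a ^+ (p ^ k)) (b ^+ (p ^ k)).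
Proof.
move=> ab; elim: k => [|k IH]; first by rewrite expn0 !expr1 expn1.
by rewrite (expnSr p k) !exprM; apply: cong_expp.
Qed.

Lemma cong_exprB (A : comPzRingType) p (a b : A) : prime p ->
  cong p ((a - b) ^+ p) (a ^+ p - b ^+ p).
Proof.
move=> pP.
have D c d : cong p ((c + d) ^+ p) (c ^+ p + d ^+ p : A).
  rewrite exprDn; case: p pP => // {}p pP.
  rewrite big_ord_recl big_ord_recr /= subn0 subnn !expr0 mulr1 mul1r.
  rewrite bin0 binn !mulr1n.
  apply: congD; first exact: cong_refl.
  rewrite -[X in cong _ _ X]add0r; apply: congD; last exact: cong_refl.
  elim/big_ind: _ => [|x y Hx Hy|i _]; first exact: cong_refl.
    by rewrite -[0]addr0; apply: congD.
  have /dvdnP[q ->] : (p.+1 %| 'C(p.+1, bump 0 i))%N.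
    by apply: prime_dvd_bin => //; rewrite /bump /= add1n ltnS /= ltn_ord.
  by eexists; rewrite mulrnA add0r.
apply/cong_sym; rewrite -{1}[a](subrK b).
apply: cong_trans (congB (D _ _) (cong_refl _ _)) _.
by rewrite addrK; apply: cong_refl.
Qed.

Section FrobeniusLift.
Variables (I : choiceType) (p : nat) (pP : prime p).

Definition frob : ipoly I -> ipoly I := peval (fun i => var i ^+ p).

HB.instance Definition _ := GRing.RMorphism.on frob.

Lemma frob_cong g : cong p (g ^+ p) (frob g).
Proof.
elim/ipoly_ind: g => [|i|a b Ha Hb|a b Ha Hb].
- by rewrite rmorph1 expr1n; apply: cong_refl.
- by rewrite /frob peval_var; apply: cong_refl.
- rewrite (rmorphB frob).
  exact: cong_trans (cong_exprB _ _ pP) (congB Ha Hb).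
- rewrite (rmorphM frob a b) exprMn.
  exact: (congM Ha Hb).
Qed.

End FrobeniusLift.

Definition ghost (A : comPzRingType) (p n : nat) (x : nat -> A) : A :=
  \sum_(i < n.+1) x i ^+ (p ^ (n - i)) *+ p ^ i.

Lemma ghost_recr (A : comPzRingType) p n (x : nat -> A) :
  ghost p n x = \sum_(i < n) x i ^+ (p ^ (n - i)) *+ p ^ i + x n *+ p ^ n.
Proof. by rewrite /ghost big_ord_recr /= subnn expr1. Qed.

Lemma ghost0 (A : comPzRingType) p (x : nat -> A) : ghost p 0 x = x 0%N.
Proof. by rewrite ghost_recr big_ord0 add0r. Qed.

Lemma ghost_morph (A B : comPzRingType) (h : {rmorphism A -> B}) p n x :
  h (ghost p n x) = ghost p n (h \o x).
Proof.
by rewrite raddf_sum; apply: eq_bigr => i _ /=; rewrite rmorphMn rmorphXn.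
Qed.

(* Dwork's lemma: in a torsion-free ring with a Frobenius lift phi, a sequence b
   is a sequence of ghost components iff b_(n+1) = phi(b_n) mod p^(n+1). *)
Section Dwork.
Variables (A : comPzRingType) (p : nat) (pP : prime p).
Variable phi : {rmorphism A -> A}.
Hypothesis tfA : forall (a : A) n, (0 < n)%N -> a *+ n = 0 -> a = 0.
Hypothesis phiP : forall a : A, cong p (a ^+ p) (phi a).

Lemma pow_gt0 n : (0 < p ^ n)%N.
Proof. by rewrite expn_gt0 prime_gt0. Qed.

Lemma ghost_frob (x : nat -> A) n :
  cong (p ^ n.+1) (\sum_(i < n.+1) x i ^+ (p ^ (n.+1 - i)) *+ p ^ i)
    (phi (ghost p n x)).
Proof.
rewrite raddf_sum /=.
apply: (cong_sum (F := fun i => x i ^+ (p ^ (n.+1 - i)) *+ p ^ i)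
  (G := fun i => phi (x i ^+ (p ^ (n - i)) *+ p ^ i))) => i.
rewrite ltnS => le; rewrite rmorphMn rmorphXn subSn //.
rewrite [in X in cong _ X _]expnS exprM.
have -> : (p ^ n.+1 = p ^ (n - i).+1 * p ^ i)%N.
  by rewrite -expnD addSn subnK.
exact/cong_mulrn/cong_exppX.
Qed.

Definition dwork (b : nat -> A) :=
  forall n, cong (p ^ n.+1) (b n.+1) (phi (b n)).

Lemma dwork_ghost x : dwork (fun n => ghost p n x).
Proof.
move=> n; rewrite /= [ghost _ n.+1 _]ghost_recr.
rewrite -[X in cong _ _ X]addr0; apply: congD; first exact: ghost_frob.
by exists (x n.+1); rewrite add0r.
Qed.

Lemma dworkD b c : dwork b -> dwork c -> dwork (fun n => b n + c n).
Proof. by move=> Hb Hc n; rewrite rmorphD; exact: congD (Hb n) (Hc n). Qed.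

Lemma dworkM b c : dwork b -> dwork c -> dwork (fun n => b n * c n).
Proof. by move=> Hb Hc n; rewrite rmorphM; exact: congM (Hb n) (Hc n). Qed.

Lemma dworkN b : dwork b -> dwork (fun n => - b n).
Proof.
move=> Hb n; rewrite rmorphN -[X in cong _ X]sub0r -[X in cong _ _ X]sub0r.
exact: congB (cong_refl _ _) (Hb n).
Qed.

Lemma ghost_inj (x y : nat -> A) :
  (forall n, ghost p n x = ghost p n y) -> x = y.
Proof.
move=> E; apply: boolp.funext => n; elim/ltn_ind: n => n IH.
have := E n; rewrite !ghost_recr.
have -> : \sum_(i < n) x i ^+ (p ^ (n - i)) *+ p ^ i =
         \sum_(i < n) y i ^+ (p ^ (n - i)) *+ p ^ i.
  by apply: eq_bigr => i _; rewrite IH.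
move=> /addrI /eqP; rewrite -subr_eq0 -mulrnBl => /eqP /(tfA (pow_gt0 n)).
by move=> /eqP; rewrite subr_eq0 => /eqP.
Qed.

Lemma ghost_surj b : dwork b -> exists x, forall n, ghost p n x = b n.
Proof.
move=> Hb.
pose F (x : nat -> A) n := \sum_(i < n) x i ^+ (p ^ (n - i)) *+ p ^ i.
pose d a n := if boolp.pselect (exists c : A, a = c *+ n) is left h
  then sval (boolp.cid h) else 0.
pose s := fix s n := if n is m.+1
  then rcons (s m) (d (b m - F (nth 0 (s m)) m) (p ^ m)%N) else [::].
pose x n := nth 0 (s n.+1) n.
have szs n : size (s n) = n by elim: n => //= n IH; rewrite size_rcons IH.
have sx n i : (i < n)%N -> nth 0 (s n) i = x i.
  elim: n => // n IH; rewrite ltnS leq_eqVlt => /orP[/eqP -> //|lt].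
  by rewrite /= nth_rcons szs lt IH.
have xE n : x n = d (b n - F x n) (p ^ n)%N.
  rewrite {1}/x /= nth_rcons szs ltnn eqxx; congr (d (_ - _) _).
  by apply: eq_bigr => i _; rewrite sx.
exists x; elim=> [|n IH]; rewrite ghost_recr -/(F x _) xE.
  rewrite /d; case: boolp.pselect => [h|[]]; last by exists (b 0%N - F x 0%N).
  by case: boolp.cid => c /= <-; rewrite addrC subrK.
rewrite /d; case: boolp.pselect => [h|[]].
  by case: boolp.cid => c /= <-; rewrite addrC subrK.
have [c Ec] : cong (p ^ n.+1) (b n.+1) (F x n.+1).
  by apply: cong_trans (Hb n) _; rewrite -IH; exact/cong_sym/ghost_frob.
by exists c; rewrite Ec addrC addKr.
Qed.

End Dwork.

Section WittPolynomials.
Variables (p : nat) (pP : prime p).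

Let X (n : nat) : ipoly (bool * nat)%type := var (false, n).
Let Y (n : nat) : ipoly (bool * nat)%type := var (true, n).

Lemma ipoly_ghost_inj (I : choiceType) (x y : nat -> ipoly I) :
  (forall n, ghost p n x = ghost p n y) -> x = y.
Proof. by apply: (ghost_inj pP) => a n; exact: ipoly_torsion_free. Qed.

Lemma ipoly_ghost_surj (I : choiceType) (b : nat -> ipoly I) :
  dwork p (frob p) b -> exists x, forall n, ghost p n x = b n.
Proof. exact: (ghost_surj (frob_cong pP)). Qed.

Lemma witt_add_ex : exists S : nat -> ipoly (bool * nat)%type,
  forall n, ghost p n S = ghost p n X + ghost p n Y.
Proof.
apply: (ipoly_ghost_surj (b := fun n => ghost p n X + ghost p n Y)).
exact: dworkD (dwork_ghost (frob_cong pP) X) (dwork_ghost (frob_cong pP) Y).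
Qed.

Lemma witt_mul_ex : exists P : nat -> ipoly (bool * nat)%type,
  forall n, ghost p n P = ghost p n X * ghost p n Y.
Proof.
apply: (ipoly_ghost_surj (b := fun n => ghost p n X * ghost p n Y)).
exact: dworkM (dwork_ghost (frob_cong pP) X) (dwork_ghost (frob_cong pP) Y).
Qed.

Lemma witt_opp_ex : exists N : nat -> ipoly nat,
  forall n, ghost p n N = - ghost p n (@var nat).
Proof.
apply: (ipoly_ghost_surj (b := fun n => - ghost p n (@var nat))).
exact: dworkN (dwork_ghost (frob_cong pP) (@var nat)).
Qed.

(* The ghost equations determine these families, by ipoly_ghost_inj. *)
Definition witt_add_poly := sval (boolp.cid witt_add_ex).
Definition witt_mul_poly := sval (boolp.cid witt_mul_ex).
Definition witt_opp_poly := sval (boolp.cid witt_opp_ex).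

Lemma witt_add_polyP n :
  ghost p n witt_add_poly = ghost p n X + ghost p n Y.
Proof. exact: (svalP (boolp.cid witt_add_ex) n). Qed.

Lemma witt_mul_polyP n :
  ghost p n witt_mul_poly = ghost p n X * ghost p n Y.
Proof. exact: (svalP (boolp.cid witt_mul_ex) n). Qed.

Lemma witt_opp_polyP n : ghost p n witt_opp_poly = - ghost p n (@var nat).
Proof. exact: (svalP (boolp.cid witt_opp_ex) n). Qed.

Section Operations.
Variable R : comPzRingType.
Implicit Types x y z : nat -> R.

Definition witt_add x y (n : nat) : R :=
  peval (fun i => if i.1 then y i.2 else x i.2) (witt_add_poly n).
Definition witt_mul x y (n : nat) : R :=
  peval (fun i => if i.1 then y i.2 else x i.2) (witt_mul_poly n).
Definition witt_opp x (n : nat) : R := peval x (witt_opp_poly n).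
Definition witt_zero (n : nat) : R := 0.
Definition witt_one (n : nat) : R := (n == 0%N)%:R.

Let ghost_add_morph (A : comPzRingType) (h : {rmorphism A -> R})
    n a b c b' c' :
  ghost p n a = ghost p n b + ghost p n c -> h \o b = b' -> h \o c = c' ->
  ghost p n (h \o a) = ghost p n b' + ghost p n c'.
Proof. by move=> /(congr1 h) + <- <-; rewrite rmorphD !ghost_morph. Qed.

Let ghost_mul_morph (A : comPzRingType) (h : {rmorphism A -> R})
    n a b c b' c' :
  ghost p n a = ghost p n b * ghost p n c -> h \o b = b' -> h \o c = c' ->
  ghost p n (h \o a) = ghost p n b' * ghost p n c'.
Proof. by move=> /(congr1 h) + <- <-; rewrite rmorphM !ghost_morph. Qed.

Let ghost_opp_morph (A : comPzRingType) (h : {rmorphism A -> R})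
    n a b b' :
  ghost p n a = - ghost p n b -> h \o b = b' ->
  ghost p n (h \o a) = - ghost p n b'.
Proof. by move=> /(congr1 h) + <-; rewrite rmorphN !ghost_morph. Qed.

Let ev2 x y : {rmorphism ipoly (bool * nat)%type -> R} :=
  peval (fun i => if i.1 then y i.2 else x i.2).

Let ev2X x y : ev2 x y \o X = x.
Proof. by apply: boolp.funext => i; apply: peval_var. Qed.

Let ev2Y x y : ev2 x y \o Y = y.
Proof. by apply: boolp.funext => i; apply: peval_var. Qed.

Lemma ghost_add x y n :
  ghost p n (witt_add x y) = ghost p n x + ghost p n y.
Proof.
exact: (ghost_add_morph (h := ev2 x y) (witt_add_polyP n)
  (ev2X x y) (ev2Y x y)).
Qed.

Lemma ghost_mul x y n :
  ghost p n (witt_mul x y) = ghost p n x * ghost p n y.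
Proof.
exact: (ghost_mul_morph (h := ev2 x y) (witt_mul_polyP n)
  (ev2X x y) (ev2Y x y)).
Qed.

Lemma ghost_opp x n : ghost p n (witt_opp x) = - ghost p n x.
Proof.
pose ev : {rmorphism ipoly nat -> R} := peval x.
have evX : ev \o @var nat = x.
  by apply: boolp.funext => i; apply: peval_var.
exact: (ghost_opp_morph (h := ev) (witt_opp_polyP n) evX).
Qed.

Lemma ghost_zero n : ghost p n witt_zero = 0.
Proof.
apply: big1 => i _; rewrite expr0n (gtn_eqF (pow_gt0 pP _)).
by rewrite mul0rn.
Qed.

Lemma ghost_one n : ghost p n witt_one = 1.
Proof.
rewrite /ghost big_ord_recl /= expr1n mulr1n big1 ?addr0 // => i _.
by rewrite /witt_one /= expr0n (gtn_eqF (pow_gt0 pP _)) mul0rn.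
Qed.

End Operations.

Section Naturality.
Variables (R S : comPzRingType) (h : {rmorphism R -> S}).
Implicit Types x y : nat -> R.

Lemma witt_add_nat x y : h \o witt_add x y = witt_add (h \o x) (h \o y).
Proof.
apply: boolp.funext => n; rewrite /= peval_comp; congr (peval _ _).
by apply: boolp.funext => -[[] i].
Qed.

Lemma witt_mul_nat x y : h \o witt_mul x y = witt_mul (h \o x) (h \o y).
Proof.
apply: boolp.funext => n; rewrite /= peval_comp; congr (peval _ _).
by apply: boolp.funext => -[[] i].
Qed.

Lemma witt_opp_nat x : h \o witt_opp x = witt_opp (h \o x).
Proof. by apply: boolp.funext => n; rewrite /= peval_comp. Qed.

Lemma witt_zero_nat : h \o @witt_zero R = @witt_zero S.
Proof. by apply: boolp.funext => n; rewrite /= rmorph0. Qed.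

Lemma witt_one_nat : h \o @witt_one R = @witt_one S.
Proof. by apply: boolp.funext => n; rewrite /= rmorph_nat. Qed.

End Naturality.

Section RingLaws.
Variable R : comPzRingType.
Implicit Types x y z : nat -> R.

(* A is the polynomial ring on the elements of R. *)
Lemma witt_lift : exists (A : comPzRingType) (ev : {rmorphism A -> R})
    (lift : (nat -> R) -> nat -> A),
  (forall x, x = ev \o lift x) /\
  (forall a b : nat -> A, (forall n, ghost p n a = ghost p n b) -> a = b).
Proof.
exists (ipoly R), (peval (@idfun R)), (fun x n => var (x n)); split=> [x|].
  by apply: boolp.funext => n; rewrite /= peval_var.
exact: ipoly_ghost_inj.
Qed.

Lemma witt_addA : associative (@witt_add R).
Proof.
have [A [ev [lift [liftK inj]]]] := witt_lift.
move=> x y z; rewrite (liftK x) (liftK y) (liftK z) -!witt_add_nat.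
congr (_ \o _); apply: inj => n.
by rewrite !ghost_add addrA.
Qed.

Lemma witt_addC : commutative (@witt_add R).
Proof.
have [A [ev [lift [liftK inj]]]] := witt_lift.
move=> x y; rewrite (liftK x) (liftK y) -!witt_add_nat.
congr (_ \o _); apply: inj => n.
by rewrite !ghost_add addrC.
Qed.

Lemma witt_add0 : left_id (@witt_zero R) (@witt_add R).
Proof.
have [A [ev [lift [liftK inj]]]] := witt_lift.
move=> x; rewrite (liftK x) -(witt_zero_nat ev) -!witt_add_nat.
congr (_ \o _); apply: inj => n.
by rewrite ghost_add ghost_zero add0r.
Qed.

Lemma witt_addN : left_inverse (@witt_zero R) (@witt_opp R) (@witt_add R).
Proof.
have [A [ev [lift [liftK inj]]]] := witt_lift.
move=> x; rewrite (liftK x) -(witt_zero_nat ev) -witt_opp_nat -!witt_add_nat.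
congr (_ \o _); apply: inj => n.
by rewrite ghost_add ghost_opp ghost_zero addNr.
Qed.

Lemma witt_mulA : associative (@witt_mul R).
Proof.
have [A [ev [lift [liftK inj]]]] := witt_lift.
move=> x y z; rewrite (liftK x) (liftK y) (liftK z) -!witt_mul_nat.
congr (_ \o _); apply: inj => n.
by rewrite !ghost_mul mulrA.
Qed.

Lemma witt_mulC : commutative (@witt_mul R).
Proof.
have [A [ev [lift [liftK inj]]]] := witt_lift.
move=> x y; rewrite (liftK x) (liftK y) -!witt_mul_nat.
congr (_ \o _); apply: inj => n.
by rewrite !ghost_mul mulrC.
Qed.

Lemma witt_mul1 : left_id (@witt_one R) (@witt_mul R).
Proof.
have [A [ev [lift [liftK inj]]]] := witt_lift.
move=> x; rewrite (liftK x) -(witt_one_nat ev) -!witt_mul_nat.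
congr (_ \o _); apply: inj => n.
by rewrite ghost_mul ghost_one mul1r.
Qed.

Lemma witt_mulDl : left_distributive (@witt_mul R) (@witt_add R).
Proof.
have [A [ev [lift [liftK inj]]]] := witt_lift.
move=> x y z; rewrite (liftK x) (liftK y) (liftK z).
rewrite -witt_add_nat -!witt_mul_nat -witt_add_nat.
congr (_ \o _); apply: inj => n.
by rewrite ghost_add !ghost_mul ghost_add mulrDl.
Qed.

End RingLaws.
End WittPolynomials.

(* The primality proof is a parameter because the ring structure depends on it,
   through the integrality of the Witt polynomials. *)
Definition witt (p : nat) (pP : prime p) (R : Type) : Type := nat -> R.

Section WittRing.
Variables (p : nat) (pP : prime p) (R : comPzRingType).

HB.instance Definition _ := boolp.gen_eqMixin (witt pP R).
HB.instance Definition _ := boolp.gen_choiceMixin (witt pP R).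

HB.instance Definition _ := GRing.isZmodule.Build (witt pP R)
  (@witt_addA p pP R) (@witt_addC p pP R) (@witt_add0 p pP R)
  (@witt_addN p pP R).

HB.instance Definition _ := GRing.Zmodule_isComPzRing.Build (witt pP R)
  (@witt_mulA p pP R) (@witt_mulC p pP R) (@witt_mul1 p pP R)
  (@witt_mulDl p pP R).

Definition witt_proj (x : witt pP R) : R := x 0%N.

Lemma witt_proj_is_zmod_morphism : zmod_morphism witt_proj.
Proof.
move=> x y; rewrite /witt_proj -!(ghost0 p) -[RHS]/(_ + - _).
by rewrite -(ghost_opp pP) -(ghost_add pP).
Qed.

Lemma witt_proj_is_monoid_morphism : monoid_morphism witt_proj.
Proof.
split=> [//|x y]; rewrite /witt_proj -!(ghost0 p).
by rewrite -(ghost_mul pP).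
Qed.

HB.instance Definition _ := GRing.isZmodMorphism.Build (witt pP R) R witt_proj
  witt_proj_is_zmod_morphism.
HB.instance Definition _ := GRing.isMonoidMorphism.Build (witt pP R) R witt_proj
  witt_proj_is_monoid_morphism.

End WittRing.

Definition restr_scalars (A B : pzRingType) (f : {rmorphism A -> B})
    (M : lmodType B)
  : Type := M.

Section Restriction.
Variables (A B : pzRingType) (f : {rmorphism A -> B}) (M : lmodType B).

HB.instance Definition _ := GRing.Zmodule.on (restr_scalars f M).

Definition restr_scale (a : A) (m : restr_scalars f M) : restr_scalars f M :=
  f a *: (m : M).

Lemma restr_scaleA a b m :
  restr_scale a (restr_scale b m) = restr_scale (a * b) m.
Proof. by rewrite /restr_scale scalerA rmorphM. Qed.

Lemma restr_scale1 : left_id 1 restr_scale.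
Proof. by move=> m; rewrite /restr_scale rmorph1 scale1r. Qed.

Lemma restr_scaleDr : right_distributive restr_scale +%R.
Proof. by move=> a m m'; rewrite /restr_scale scalerDr. Qed.

Lemma restr_scaleDl m : {morph restr_scale^~ m : a b / a + b}.
Proof. by move=> a b; rewrite /restr_scale rmorphD scalerDl. Qed.

HB.instance Definition _ := GRing.Zmodule_isLmodule.Build A (restr_scalars f M)
  restr_scaleA restr_scale1 restr_scaleDr restr_scaleDl.

End Restriction.

Section ProjectiveDimension.
Variable A : pzRingType.

Definition projective (P : lmodType A) : Prop :=
  forall (M N : lmodType A) (f : {linear M -> N}) (g : {linear P -> N}),
    (forall y, exists x, f x = y) ->
    exists h : {linear P -> M}, forall x, f (h x) = g x.

Record projective_resolution (M : lmodType A) (n : nat) := {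
  res_obj : nat -> lmodType A;
  res_diff : forall i, {linear res_obj i.+1 -> res_obj i};
  res_aug : {linear res_obj 0%N -> M};
  res_projective : forall i, projective (res_obj i);
  res_bounded : forall i, (n < i)%N -> forall x : res_obj i, x = 0;
  res_aug_surj : forall y, exists x, res_aug x = y;
  res_exact0 : forall x, res_aug x = 0 <-> exists y, res_diff 0%N y = x;
  res_exactS : forall i x,
    res_diff i x = 0 <-> exists y, res_diff i.+1 y = x
}.

Definition has_resolution (M : lmodType A) : pred nat :=
  fun n => boolp.asbool (inhabited (projective_resolution M n)).

(* The least length of a projective resolution, with the usual convention
   pdim 0 = -oo. *)
Definition pdim (M : lmodType A) : \bar int :=
  if boolp.pselect (forall x : M, x = 0) then -oo%E
  else if boolp.pselect (exists n, has_resolution M n) is left h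
  then (ex_minn h)%:Z%:E else +oo%E.

End ProjectiveDimension.

Definition perfect_Fp_algebra (p : nat) (R : comPzRingType) : Prop :=
  p%:R = 0 :> R /\ bijective (fun x : R => x ^+ p).

(* Main.v *)
From HB Require Import structures.
From mathcomp Require Import all_boot all_order all_algebra finmap.
From mathcomp Require Import generic_quotient.
From mathcomp.multinomials Require Import monalg.
From mathcomp Require boolp.
From mathcomp Require Import constructive_ereal.
Require Import Defs.

Set Implicit Arguments.
Unset Strict Implicit.
Unset Printing Implicit Defensive.

Import GRing.Theory.
Local Open Scope ring_scope.

(** The statement is the classical change of rings theorem for the quotient
    of a commutative ring A by a nonzerodivisor x, applied to A = W(R) and
    x = p. The quotient of W(R) by p is R, and p is regular, because over a
    perfect R the product of p with (a_0, a_1, ...) is (0, a_0^p, a_1^p, ...):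
    the formula p = VF, lemma [witt_mulrp], proved on ghost components over a
    polynomial ring and then specialized.

    Projective dimension at most n is handled through [pd_le], the existence
    of n successive syzygies ending in a projective module. Three inequalities
    for a short exact sequence 0 -> X -> Y -> Z -> 0 are enough, and all come
    from the horseshoe construction: [pd_le_extension] bounds Y,
    [pd_le_kernel] bounds X and [pd_le_cokernel] bounds Z.

    Let B = A/x and let M be a B-module.

    Upper bound ([res_pd_le]). A projective B-module has dimension at most 1
    over A; the general case follows along a B-syzygy of M by
    [pd_le_cokernel].

    Lower bound ([res_pd_le_descent]). Take a syzygy 0 -> K -> P -> M -> 0
    over A, with P projective. Since x is regular on P and kills M, reduction
    modulo x gives an exact sequence 0 -> M -> K/xK -> P/xP -> M -> 0, in
    which the M on the left is Tor_1(M, B). Let L be the image of the middle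
    map. If the dimension of M over A is at most n+1, that of K is at most n,
    and hence so is that of K/xK over B ([reduction_pd_le]), K being
    torsion-free. If the dimension of M over B is at most d+1 with d >= n,
    then L, being a syzygy of M, has dimension at most d, and
    0 -> M -> K/xK -> L -> 0 bounds that of M by d. Starting from any finite
    bound one descends to n; this is where finiteness over B is used.
    Finally, a nonzero M is not projective over A, since x kills it. *)

(** * Linear maps and kernels *)

Section LinearMaps.
Variable A : pzRingType.
Implicit Types M N K P X Y Z W : lmodType A.

Definition mk_linear M N (h : M -> N) (hP : linear h) : {linear M -> N} :=
  HB.pack h (GRing.isLinear.Build A M N *:%R h hP).

(** Kernels, pullbacks and comparison maps below are never manipulated up to
    isomorphism: maps into a submodule come from this lemma, and maps out of a
    quotient from the next one. *)
Lemma linear_factor X K P (i : {linear K -> P}) (g : {linear X -> P}) :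
  injective i -> (forall x, exists k, i k = g x) ->
  exists h : {linear X -> K}, forall x, i (h x) = g x.
Proof.
move=> injI im; pose h x := sval (boolp.cid (im x)).
have hE x : i (h x) = g x := svalP (boolp.cid (im x)).
have hP : linear h by move=> a u v; apply: injI; rewrite linearP !hE linearP.
by exists (mk_linear hP).
Qed.

Lemma linear_descend P M N (e : {linear P -> M}) (g : {linear P -> N}) :
  (forall y, exists x, e x = y) -> (forall x, e x = 0 -> g x = 0) ->
  exists h : {linear M -> N}, forall x, h (e x) = g x.
Proof.
move=> surjE ker; pose s y := sval (boolp.cid (surjE y)).
have sE y : e (s y) = y := svalP (boolp.cid (surjE y)).
have eqg x y : e x = e y -> g x = g y.
  move=> exy; have := ker (x - y); rewrite !linearB exy subrr => /(_ erefl).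
  by move/eqP; rewrite subr_eq0 => /eqP.
have hP : linear (g \o s).
  by move=> a u v; rewrite /= -linearP; apply: eqg; rewrite linearP !sE.
by exists (mk_linear hP) => x; apply: eqg; rewrite sE.
Qed.

Section Kernel.
Variables (M N : lmodType A) (f : {linear M -> N}).

Definition ker_pred : pred M := [pred m | f m == 0].

Lemma ker_pred_closed : submod_closed ker_pred.
Proof.
split=> [|a u v]; rewrite !inE; first by rewrite raddf0.
by move=> /eqP fu /eqP fv; rewrite linearP fu fv scaler0 addr0.
Qed.

HB.instance Definition _ := GRing.isSubmodClosed.Build A M ker_pred
  ker_pred_closed.

Definition ker_mod : Type := {m : M | ker_pred m}.
HB.instance Definition _ := SubChoice.on ker_mod.
HB.instance Definition _ := [SubChoice_isSubLmodule of ker_mod by <:].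

Lemma ker_modP (m : ker_mod) : f (val m) = 0.
Proof. exact/eqP/(valP m). Qed.

Definition ker_val : {linear ker_mod -> M} :=
  mk_linear (fun a u v => linearP (val : {linear ker_mod -> M}) a u v).

End Kernel.
End LinearMaps.

Section Exactness.
Variable A : pzRingType.
Implicit Types M N K P X Y Z W : lmodType A.

Definition short_exact X Y Z (i : {linear X -> Y}) (e : {linear Y -> Z}) :=
  [/\ injective i, forall z, exists y, e y = z &
      forall y, e y = 0 <-> exists x, i x = y].

Lemma short_exact_ker Y Z (e : {linear Y -> Z}) :
  (forall z, exists y, e y = z) -> short_exact (ker_val e) e.
Proof.
move=> surjE; split=> //; first exact: val_inj.
move=> y; split=> [ey|[x <-]]; last exact: ker_modP.
by exists (exist _ y (introT eqP ey)).
Qed.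

Lemma linear_inj0 M N (f : {linear M -> N}) :
  (forall x, f x = 0 -> x = 0) -> injective f.
Proof.
move=> inj0 x y fxy; apply/eqP; rewrite -subr_eq0; apply/eqP/inj0.
by rewrite linearB fxy subrr.
Qed.

Lemma linear_comb X P Y (f : {linear X -> Y}) (g : {linear P -> Y}) :
  linear (fun u : X * P => f u.1 + g u.2).
Proof.
by move=> a u v; rewrite !linearP scalerDr addrACA.
Qed.

Lemma linear_pair X P Y (f : {linear Y -> X}) (g : {linear Y -> P}) :
  linear (fun y => (f y, g y) : (X * P)%type).
Proof. by move=> a u v; rewrite !linearP. Qed.

Lemma linear_inl X P : linear (fun x => (x, 0) : (X * P)%type).
Proof. by move=> a u v; congr (_, _); rewrite /= scaler0 addr0. Qed.

Lemma linear_inr X P : linear (fun p => (0, p) : (X * P)%type).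
Proof. by move=> a u v; congr (_, _); rewrite /= scaler0 addr0. Qed.

Lemma projective_retract W X (r : {linear W -> X}) (s : {linear X -> W}) :
  (forall x, r (s x) = x) -> projective W -> projective X.
Proof.
move=> rsK projW M N f g surjF.
have [h hE] := projW M N f (g \o r) surjF.
by exists (h \o s : {linear X -> M}) => x; rewrite /= hE /= rsK.
Qed.

Lemma projective_prod X P : projective X -> projective P ->
  projective (X * P : lmodType A)%type.
Proof.
move=> projX projP M N f g surjF.
have [h1 h1E] := projX _ _ f (g \o mk_linear (@linear_inl X P)) surjF.
have [h2 h2E] := projP _ _ f (g \o mk_linear (@linear_inr X P)) surjF.
exists (mk_linear (linear_comb h1 h2)) => -[a b] /=.
rewrite linearD h1E h2E /= -linearD; congr (g _).
have -> : ((a, 0) + (0, b) : (X * P)%type) = (a + 0, 0 + b) by [].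
by rewrite addr0 add0r.
Qed.

Lemma projective_section X P (e : {linear X -> P}) :
  projective P -> (forall y, exists x, e x = y) ->
  exists s : {linear P -> X}, forall y, e (s y) = y.
Proof. by move=> projP /(projP _ _ e idfun). Qed.

End Exactness.

(** * Projective dimension and short exact sequences *)

Section ProjectiveDimensionBound.
Variable A : pzRingType.
Implicit Types M N K P X Y Z W : lmodType A.

(** Any module playing the role of the syzygy is accepted, through an exact
    sequence, so that [pd_le] transfers along isomorphisms for free. *)
Fixpoint pd_le (n : nat) M : Prop :=
  if n is m.+1 then
    exists K P (i : {linear K -> P}) (e : {linear P -> M}),
      [/\ projective P, short_exact i e & pd_le m K]
  else projective M.

Lemma pd_leS n M : pd_le n M -> pd_le n.+1 M.
Proof.
elim: n M => [|n IHn] M; last first.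
  move=> [K [P [i [e [projP ex pdK]]]]].
  by exists K, P, i, e; split=> //; apply: IHn.
move=> projM.
have surj1 (y : M) : exists x, (idfun : {linear M -> M}) x = y.
  by exists y.
exists (ker_mod (idfun : {linear M -> M})), M, (ker_val idfun), idfun.
split=> //; first exact: (short_exact_ker surj1).
move=> X Y f g _; exists \0%R => k.
have -> : k = 0 by apply: val_inj; apply: (ker_modP k).
by rewrite !linear0.
Qed.

Lemma pd_le_leq m n M : (m <= n)%N -> pd_le m M -> pd_le n M.
Proof.
move=> /subnK <-; elim: (n - m)%N => //= k IHk pdM.
exact: pd_leS (IHk pdM).
Qed.

(** The horseshoe lemma: covers P1 of X and P2 of Z assemble to a cover P1 * P2
    of Y, by lifting P2 -> Z to Y, and the kernels again form a short exact
    sequence. *)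
Lemma pd_le_extension n X Y Z (i : {linear X -> Y}) (e : {linear Y -> Z}) :
  short_exact i e -> pd_le n X -> pd_le n Z -> pd_le n Y.
Proof.
elim: n X Y Z i e => [|n IHn] X Y Z i e [injI surjE kerE].
  move=> projX projZ; have [s sE] := projective_section projZ surjE.
  have im (y : Y) : exists x, i x = (idfun \- (s \o e)) y.
    by apply/kerE; rewrite linearB /= sE subrr.
  have [r rE] := linear_factor injI im.
  have projXZ := projective_prod projX projZ.
  apply: (projective_retract (r := mk_linear (linear_comb i s))
    (s := mk_linear (linear_pair r e))) projXZ => y /=.
  by rewrite rE /= subrK.
move=> [K1 [P1 [i1 [e1 [projP1 [inj1 surj1 ker1] pdK1]]]]].
move=> [K2 [P2 [i2 [e2 [projP2 [inj2 surj2 ker2] pdK2]]]]].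
have [l lE] := projP2 _ _ e e2 surjE.
pose E := mk_linear (linear_comb (i \o e1 : {linear P1 -> Y}) l).
have EE a b : E (a, b) = i (e1 a) + l b by [].
have EE' u : E u = i (e1 u.1) + l u.2 by [].
have ie x : e (i x) = 0 by apply/kerE; exists x.
have surjEE y : exists u, E u = y.
  have [b be] := surj2 (e y).
  have [x xE] : exists x, i x = y - l b.
    by apply/kerE; rewrite linearB lE be subrr.
  have [a aE] := surj1 x.
  by exists (a, b); rewrite EE aE xE subrK.
have inl_ker k : exists u, ker_val E u = mk_linear (@linear_inl _ P1 P2) (i1 k).
  have [_ _ kerEE] := short_exact_ker surjEE; apply/kerEE.
  have e10 : e1 (i1 k) = 0 by apply/ker1; exists k.
  by apply: etrans (EE (i1 k) 0) _; rewrite e10 !linear0 addr0.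
have injE : injective (ker_val E) by have [] := short_exact_ker surjEE.
have [j jE] := linear_factor (g := mk_linear (@linear_inl _ P1 P2) \o i1)
  injE inl_ker.
have snd_lin : linear (fun u : ker_mod E => (val u).2) by [].
have snd_ker (u : ker_mod E) : exists k, i2 k = mk_linear snd_lin u.
  apply/ker2; have := congr1 e (ker_modP u).
  by rewrite EE' linearD ie lE linear0 add0r.
have [q qE] := linear_factor inj2 snd_ker.
exists (ker_mod E), (P1 * P2)%type, (ker_val E), E; split.
- exact: projective_prod.
- exact: (short_exact_ker surjEE).
- apply: (IHn K1 _ K2 j q) => //; split.
  + apply: linear_inj0 => k jk; apply: inj1; have := jE k.
    by rewrite jk linear0 => /(congr1 fst) /= <-; rewrite ?linear0.
  + move=> k; have [x xE] : exists x, i x = l (i2 k).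
      by apply/kerE; rewrite lE; apply/ker2; exists k.
    have [a aE] := surj1 x.
    have Eu : E (- a, i2 k) == 0 by rewrite EE !linearN aE xE addNr.
    by exists (exist _ (- a, i2 k) Eu); apply: inj2; rewrite qE.
  + move=> u; split=> [qu|[k <-]]; last first.
      by apply: inj2; rewrite qE /= linear0; have /= := jE k => ->.
    have u2 : (val u).2 = 0 by have := qE u; rewrite qu linear0.
    have := ker_modP u; rewrite EE' u2 linear0 addr0 => ie0.
    have /ker1[k kE] : e1 (val u).1 = 0 by apply: injI; rewrite ie0 linear0.
    by exists k; apply: injE; rewrite jE /= kE -[in LHS]u2 -surjective_pairing.
Qed.

(** The sequence splits, so a cover of W composed with the retraction W -> X is
    a cover of X; its kernel is an extension of P by the syzygy of W. *)
Lemma pd_le_split n X W P (i : {linear X -> W}) (e : {linear W -> P}) :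
  short_exact i e -> projective P -> pd_le n W -> pd_le n X.
Proof.
move=> [injI surjE kerE] projP; have [s sE] := projective_section projP surjE.
have im (w : W) : exists x, i x = (idfun \- (s \o e)) w.
  by apply/kerE; rewrite linearB /= sE subrr.
have [r rE] := linear_factor injI im.
have ie x : e (i x) = 0 by apply/kerE; exists x.
have riK x : r (i x) = x by apply: injI; rewrite rE /= ie linear0 subr0.
have rs p : r (s p) = 0 by apply: injI; rewrite rE /= sE subrr linear0.
case: n => [|n]; first exact: projective_retract riK.
move=> [K [F [j [q [projF [injJ surjQ kerQ] pdK]]]]].
pose c : {linear F -> X} := r \o q.
have surjC x : exists y, c y = x.
  by have [y yE] := surjQ (i x); exists y; rewrite /= yE riK.
have [injK _ kerC] := short_exact_ker surjC.
have jC k : exists u, ker_val c u = j k.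
  by apply/kerC => /=; rewrite (kerQ (j k)).2 ?linear0 //; exists k.
have [j' jE] := linear_factor injK jC.
exists (ker_mod c), F, (ker_val c), c; split=> //.
apply: (pd_le_extension (n := n) (i := j')
  (e := e \o q \o ker_val c) _ pdK _); last first.
  exact: (pd_le_leq (leq0n n)).
split.
- apply: linear_inj0 => k jk; apply: injJ.
  by rewrite -jE jk !linear0.
- move=> p; have [y yE] := surjQ (s p).
  have yC : c y == 0 by rewrite /= yE rs.
  by exists (exist _ y yC) => /=; rewrite yE sE.
- move=> u; split=> [/= eq0|[k <-]]; last first.
    rewrite /= -[ssrfun.sval _]/(ker_val c (j' k)) jE.
    by rewrite (kerQ (j k)).2 ?linear0 //; exists k.
  have /kerQ[k kE] : q (val u) = 0.
    have /kerE[x xE] := eq0; rewrite -xE -[x]riK xE.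
    by have /= -> := ker_modP u; rewrite linear0.
  by exists k; apply: injK; rewrite jE kE.
Qed.

(** In the pullback W of Y -> Z along a cover P -> Z, the sequence
    0 -> X -> W -> P -> 0 splits, while 0 -> N -> W -> Y -> 0 bounds the
    dimension of W, where N is the kernel of P -> Z. This contains Schanuel's
    lemma: for Y projective, every syzygy of Z drops the dimension. *)
Lemma pd_le_kernel n X Y Z (i : {linear X -> Y}) (e : {linear Y -> Z}) :
  short_exact i e -> pd_le n Y -> pd_le n.+1 Z -> pd_le n X.
Proof.
move=> [injI surjE kerE] pdY [N [P [j [q [projP [injJ surjQ kerQ] pdN]]]]].
pose d := mk_linear (linear_comb e (\- q : {linear P -> Z})).
have dE y p : d (y, p) = e y - q p by [].
have surjD z : exists u, d u = z.
  by have [y yE] := surjE z; exists (y, 0); rewrite dE linear0 subr0.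
have [injK _ kerD] := short_exact_ker surjD.
have fst_lin : linear (fun u : ker_mod d => (val u).1) by [].
have snd_lin : linear (fun u : ker_mod d => (val u).2) by [].
have inlD x : exists u, ker_val d u = (mk_linear (@linear_inl _ Y P) \o i) x.
  by apply/kerD; rewrite /= linear0 subr0; apply/kerE; exists x.
have inrD k : exists u, ker_val d u = (mk_linear (@linear_inr _ Y P) \o j) k.
  by apply/kerD; rewrite /= linear0 sub0r (kerQ (j k)).2 ?oppr0 //; exists k.
have [a aE] := linear_factor injK inlD.
have [b bE] := linear_factor injK inrD.
have eqD (u : ker_mod d) : e (val u).1 = q (val u).2.
  have := ker_modP u; case: (val u) => y p.
  by rewrite dE => /eqP; rewrite subr_eq0 => /eqP.
apply: (pd_le_split (i := a) (e := mk_linear snd_lin)) => //.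
- split.
  + apply: linear_inj0 => x ax; apply: injI; have := aE x.
    by rewrite ax linear0 => /(congr1 fst) /= <-; rewrite ?linear0.
  + move=> p; have [y yE] := surjE (q p).
    have yp : d (y, p) == 0 by rewrite dE yE subrr.
    by exists (exist _ (y, p) yp).
  + move=> u; split=> [u2|[x <-]]; last first.
      by rewrite /= -[ssrfun.sval _]/(ker_val d (a x)) aE.
    have {}u2 : (val u).2 = 0 := u2.
    have := eqD u; rewrite u2 linear0 => /kerE[x xE].
    by exists x; apply: injK; rewrite aE /= xE -[in LHS]u2 -surjective_pairing.
- apply: (pd_le_extension (n := n) (i := b)
    (e := mk_linear fst_lin) _ pdN pdY); split.
  + apply: linear_inj0 => k bk; apply: injJ; have := bE k.
    by rewrite bk linear0 => /(congr1 snd) /= <-; rewrite ?linear0.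
  + move=> y; have [p pE] := surjQ (e y).
    have yp : d (y, p) == 0 by rewrite dE pE subrr.
    by exists (exist _ (y, p) yp).
  + move=> u; split=> [u1|[k <-]]; last first.
      by rewrite /= -[ssrfun.sval _]/(ker_val d (b k)) bE.
    have {}u1 : (val u).1 = 0 := u1.
    have := eqD u; rewrite u1 linear0 => /esym/kerQ[k kE].
    by exists k; apply: injK; rewrite bE /= kE -[in LHS]u1 -surjective_pairing.
Qed.

(** For a cover P -> Y with kernel N, the kernel of P -> Z is an extension of X
    by N. *)
Lemma pd_le_cokernel n X Y Z (i : {linear X -> Y}) (e : {linear Y -> Z}) :
  short_exact i e -> pd_le n X -> pd_le n.+1 Y -> pd_le n.+1 Z.
Proof.
move=> [injI surjE kerE] pdX [N [P [j [q [projP [injJ surjQ kerQ] pdN]]]]].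
pose c : {linear P -> Z} := e \o q.
have surjC z : exists p, c p = z.
  have [y yE] := surjE z; have [p pE] := surjQ y.
  by exists p; rewrite /= pE yE.
have [injK _ kerC] := short_exact_ker surjC.
have jC k : exists u, ker_val c u = j k.
  by apply/kerC; rewrite /= (kerQ (j k)).2 ?linear0 //; exists k.
have [j' jE] := linear_factor injK jC.
have qI (u : ker_mod c) : exists x, i x = (q \o ker_val c) u.
  by apply/kerE; exact: (ker_modP u).
have [t tE] := linear_factor injI qI.
exists (ker_mod c), P, (ker_val c), c; split=> //.
apply: (pd_le_extension (n := n) (i := j') (e := t) _ pdN pdX); split.
- apply: linear_inj0 => k jk; apply: injJ.
  by rewrite -jE jk !linear0.
- move=> x; have [p pE] := surjQ (i x).
  have pC : c p == 0 by apply/eqP; rewrite /= pE; apply/kerE; exists x.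
  by exists (exist _ p pC); apply: injI; rewrite tE.
- move=> u; split=> [tu|[k <-]].
    have := tE u; rewrite tu linear0 => /esym/kerQ[k kE].
    by exists k; apply: injK; rewrite jE.
  apply: injI; rewrite tE linear0 /= -[ssrfun.sval _]/(ker_val c (j' k)) jE.
  by apply/kerQ; exists k.
Qed.

End ProjectiveDimensionBound.

(** * Resolutions and free modules *)

Section Resolutions.
Variable A : pzRingType.

(** The kernel of the augmentation is resolved by the shifted complex. *)
Lemma resolution_pd_le n (M : lmodType A) :
  projective_resolution M n -> pd_le n M.
Proof.
elim: n M => [|n IHn] M [Pi d e projP bnd surjE ex0 exS].
  have injE : injective e.
    apply: linear_inj0 => x /ex0[y <-].
    by rewrite (bnd 1%N isT y) linear0.
  have [g gE] := linear_factor (g := idfun) injE surjE.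
  by apply: (projective_retract gE); exact: projP.
have imd x : exists k, ker_val e k = d 0%N x.
  have [_ _ kerE] := short_exact_ker surjE.
  by apply/kerE/ex0; exists x.
have exE := short_exact_ker surjE; have [injK _ kerE] := exE.
have [e' e'E] := linear_factor injK imd.
exists (ker_mod e), (Pi 0%N), (ker_val e), e; split=> //.
apply: IHn; exists (fun i => Pi i.+1) (fun i => d i.+1) e' => //.
- by move=> i lt_n_i; apply: bnd.
- move=> k; have /ex0[y yE] := ker_modP k; exists y; apply: injK.
  by rewrite e'E yE.
- move=> x; rewrite -exS -e'E; split=> [->|]; first by rewrite linear0.
  by move=> e'x; apply: injK; rewrite e'x linear0.
Qed.

Lemma pd_le_resolution n (M : lmodType A) :
  pd_le n M -> inhabited (projective_resolution M n).
Proof.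
elim: n M => [|n IHn] M.
  move=> projM.
  (* Z is the zero module, which fills the positive degrees. *)
  pose Z : lmodType A := ker_mod (idfun : {linear M -> M}).
  have Z0 (z : Z) : z = 0 by apply: val_inj; apply: (ker_modP z).
  pose Pi i : lmodType A := if i is 0%N then M else Z.
  exists; exists Pi (fun i => \0%R) idfun => //.
  - case=> [//|i] X Y f g _; exists \0%R => z.
    by have -> : z = 0 := Z0 z; rewrite !linear0.
  - by case=> [//|i] _; apply: Z0.
  - by move=> y; exists y.
  - by move=> x; split=> [/= ->|[y <-]] //; exists 0.
  - by move=> i x; split=> // _; exists 0; have -> : x = 0 := Z0 x.
move=> [K [P [j [e [projP [injJ surjE kerE] /IHn resK]]]]].
have [[Pi d a projPi bnd surjA ex0 exS]] := resK.
pose Qi i : lmodType A := if i is k.+1 then Pi k else P.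
pose D i : {linear Qi i.+1 -> Qi i} :=
  match i with 0%N => j \o a | k.+1 => d k end.
exists; exists Qi D e => //.
- by case=> [//|i]; apply: projPi.
- by case=> [//|i] lt_n_i; apply: bnd.
- move=> x; rewrite kerE; split=> [[k <-]|[y <-]]; last by exists (a y).
  by have [y yE] := surjA k; exists y; rewrite /= yE.
- case=> [|i] x; last exact: exS.
  apply: iff_trans (ex0 x); split=> [ja|ax]; last by rewrite /= ax linear0.
  by apply: injJ; rewrite linear0.
Qed.

Lemma has_resolutionE n (M : lmodType A) : has_resolution M n <-> pd_le n M.
Proof.
rewrite /has_resolution; split=> [/boolp.asboolP[]|pdM].
  exact: resolution_pd_le.
exact/boolp.asboolP/pd_le_resolution.
Qed.

End Resolutions.

Section FreeModule.
Variables (A : pzRingType) (S : choiceType).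

(** The finitely supported functions carry a module structure of their own here
    so that the ring of coefficients may be the zero ring. *)
Definition free_mod : Type := {malg A[S]}.
HB.instance Definition _ := GRing.Zmodule.on free_mod.

Definition free_scale (a : A) (g : free_mod) : free_mod :=
  \sum_(k <- msupp g) << a * g@_k *g k >>.

Lemma free_scaleE a g k : (free_scale a g)@_k = a * g@_k.
Proof.
rewrite [g in RHS]monalgE !raddf_sum mulr_sumr.
by apply: eq_bigr => i _; rewrite /= !mcoeffU mulrnAr.
Qed.

Lemma free_scaleA a b g : free_scale a (free_scale b g) = free_scale (a * b) g.
Proof. by apply/malgP => k; rewrite !free_scaleE mulrA. Qed.

Lemma free_scale1 : left_id 1 free_scale.
Proof. by move=> g; apply/malgP => k; rewrite free_scaleE mul1r. Qed.

Lemma free_scaleDr : right_distributive free_scale +%R.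
Proof.
by move=> a g h; apply/malgP => k; rewrite mcoeffD !free_scaleE mcoeffD mulrDr.
Qed.

Lemma free_scaleDl g : {morph free_scale^~ g : a b / a + b}.
Proof.
by move=> a b; apply/malgP => k; rewrite mcoeffD !free_scaleE mulrDl.
Qed.

HB.instance Definition _ := GRing.Zmodule_isLmodule.Build A free_mod
  free_scaleA free_scale1 free_scaleDr free_scaleDl.

Definition free_gen (k : S) : free_mod := << 1 *g k >>.

Lemma free_genE (g : free_mod) : g = \sum_(k <- msupp g) g@_k *: free_gen k.
Proof.
rewrite {1}[g]monalgE; apply: eq_bigr => k _; apply/malgP => l.
by rewrite free_scaleE !mcoeffU mulrnAr mulr1.
Qed.

Section Universal.
Variables (M : lmodType A) (s : S -> M).

Definition free_ev (g : free_mod) : M := \sum_(k <- msupp g) g@_k *: s k.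

Lemma free_evEw (d : {fset S}) (g : free_mod) : (msupp g `<=` d)%fset ->
  free_ev g = \sum_(k <- d) g@_k *: s k.
Proof.
move=> le; apply: big_fset_incl => // k _ /mcoeff_outdom ->.
by rewrite scale0r.
Qed.

Lemma free_ev_linear : linear free_ev.
Proof.
move=> a g h.
pose d := (msupp (a *: g + h : free_mod) `|` msupp g `|` msupp h)%fset.
rewrite (free_evEw (d := d) (g := a *: g + h)); last first.
  by apply/fsubsetP => k; rewrite !inE => ->.
rewrite (free_evEw (d := d) (g := g)); last first.
  by apply/fsubsetP => k; rewrite !inE => ->; rewrite orbT.
rewrite (free_evEw (d := d) (g := h)); last first.
  by apply/fsubsetP => k; rewrite !inE => ->; rewrite !orbT.
rewrite scaler_sumr -big_split; apply: eq_bigr => k _ /=.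
by rewrite mcoeffD free_scaleE scalerDl scalerA.
Qed.

Lemma free_ev_gen k : free_ev (free_gen k) = s k.
Proof. by rewrite (free_evEw msuppU_le) big_seq_fset1 mcoeffUU scale1r. Qed.

End Universal.

Lemma free_mod_projective : projective (free_mod : lmodType A).
Proof.
move=> M N f g surjF.
pose s k := sval (boolp.cid (surjF (g (free_gen k)))).
have sE k : f (s k) = g (free_gen k) :=
  svalP (boolp.cid (surjF (g (free_gen k)))).
exists (mk_linear (free_ev_linear s)) => u /=.
rewrite [u in RHS]free_genE !linear_sum; apply: eq_bigr => k _.
by rewrite !linearZ sE.
Qed.

End FreeModule.

Lemma free_cover (A : pzRingType) (M : lmodType A) :
  exists e : {linear free_mod A M -> M}, forall y, exists x, e x = y.
Proof.
exists (mk_linear (free_ev_linear (fun m : M => m))) => y.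
by exists (free_gen A y); rewrite /= free_ev_gen.
Qed.

(** * Change of rings modulo a nonzerodivisor *)

Section ChangeOfRings.
Variables (A B : comPzRingType) (f : {rmorphism A -> B}) (x : A).
Hypothesis surjF : forall b, exists a, f a = b.
Hypothesis kerF : forall a, f a = 0 <-> exists a', a = x * a'.
Hypothesis regX : forall a, x * a = 0 -> a = 0.

Local Notation res M := (restr_scalars f M : lmodType A).

(** Torsion means x-torsion only. *)
Definition torsion_free (M : lmodType A) := forall m : M, x *: m = 0 -> m = 0.

Lemma fx0 : f x = 0.
Proof. by apply/kerF; exists 1; rewrite mulr1. Qed.

Lemma res_x (M : lmodType B) (m : res M) : x *: m = 0.
Proof. by have : f x *: (m : M) = 0 by rewrite fx0 scale0r. Qed.

Lemma mulx_linear (M : lmodType A) : linear (fun m : M => x *: m).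
Proof. by move=> a u v; rewrite scalerDr !scalerA mulrC. Qed.

Lemma torsion_free_inj (M N : lmodType A) (i : {linear M -> N}) :
  injective i -> torsion_free N -> torsion_free M.
Proof.
move=> injI tfN m xm; apply: injI; rewrite linear0; apply: tfN.
by rewrite -linearZ xm linear0.
Qed.

(** A projective module embeds in a free one, on which x acts
    coordinatewise. *)
Lemma torsion_free_projective (P : lmodType A) : projective P -> torsion_free P.
Proof.
move=> projP; have [e surjE] := free_cover P.
have [s sE] := projective_section projP surjE.
apply: (torsion_free_inj (i := s)) => [|g xg]; first exact: can_inj sE.
apply/malgP => k; rewrite mcoeff0; apply: regX.
by rewrite -[x * _](free_scaleE x g k) -[free_scale x g]/(x *: g) xg mcoeff0.
Qed.

Lemma res_linear (M N : lmodType B) (g : {linear M -> N}) :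
  linear (g : res M -> res N).
Proof. by move=> a u v; rewrite -[LHS]/(g (f a *: (u : M) + v)) linearP. Qed.

(** Restriction of scalars along a surjection is fully faithful. *)
Lemma res_linear_conv (M N : lmodType B) (g : {linear res M -> res N}) :
  linear (g : M -> N).
Proof.
by move=> b u v; have [a <-] := surjF b; apply: (linearP g a u v).
Qed.

Section Reduction.
Variable M : lmodType A.

Definition mulx_pred : {pred M} :=
  fun m => boolp.asbool (exists m', m = x *: m').

Lemma mulx_predP m : reflect (exists m', m = x *: m') (m \in mulx_pred).
Proof. exact: boolp.asboolP. Qed.

Lemma mulx_pred_closed : zmod_closed mulx_pred.
Proof.
split=> [|_ _ /mulx_predP[u ->] /mulx_predP[v ->]]; apply/mulx_predP.
  by exists 0; rewrite scaler0.
by exists (u - v); rewrite scalerBr.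
Qed.

HB.instance Definition _ := GRing.isZmodClosed.Build M mulx_pred
  mulx_pred_closed.

End Reduction.

(** pi exhibits N as M/xM. *)
Definition is_reduction (M : lmodType A) (N : lmodType B)
    (pi : {linear M -> res N}) :=
  (forall n, exists m, pi m = n) /\
  (forall m, pi m = 0 <-> exists m', m = x *: m').

(** A scalar b of B acts on M/xM through an arbitrary lift to A, on an arbitrary
    representative: both choices are irrelevant modulo x. *)
Lemma reduction_exists (M : lmodType A) :
  exists (N : lmodType B) (pi : {linear M -> res N}), is_reduction pi.
Proof.
pose I : zmodClosed M := @mulx_pred M.
pose Q : zmodType := Quotient.quot I.
pose pr (m : M) : Q := (\pi_(Quotient.quot I) m)%qT.
have prB : {morph pr : u v / u - v} by move=> u v; rewrite /pr !piE.
have prD : {morph pr : u v / u + v} by move=> u v; rewrite /pr !piE.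
have prP u v : pr u = pr v <-> exists m, u - v = x *: m.
  split=> [/eqP|uv]; first by rewrite -Quotient.idealrBE => /mulx_predP.
  by apply/eqP; rewrite -Quotient.idealrBE; apply/mulx_predP.
pose rep (q : Q) : M := repr (q : Quotient.quot I).
have prK q : pr (rep q) = q by exact: reprK.
pose lift b := sval (boolp.cid (surjF b)).
have liftK b : f (lift b) = b := svalP (boolp.cid (surjF b)).
pose sc b (q : Q) : Q := pr (lift b *: rep q).
have scE a m : sc (f a) (pr m) = pr (a *: m).
  apply/prP; have /prP[m' mE] := prK (pr m).
  have [a' aE] : exists a', lift (f a) - a = x * a'.
    by apply/kerF; rewrite rmorphB liftK subrr.
  exists (lift (f a) *: m' + a' *: m).
  rewrite scalerDr scalerA mulrC -scalerA -mE scalerA -aE.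
  by rewrite scalerBr scalerBl addrA subrK.
have scA b c q : sc b (sc c q) = sc (b * c) q.
  by rewrite -[b]liftK -[c]liftK -[q]prK -rmorphM !scE scalerA.
have sc1 : left_id 1 sc.
  by move=> q; rewrite -[q]prK -(rmorph1 f) scE scale1r.
have scDr : right_distributive sc +%R.
  by move=> b q r; rewrite -[b]liftK -[q]prK -[r]prK -prD !scE scalerDr prD.
have scDl q : {morph sc^~ q : b c / b + c}.
  by move=> b c; rewrite -[b]liftK -[c]liftK -[q]prK -rmorphD !scE scalerDl prD.
pose N : lmodType B :=
  HB.pack (Quotient.quot I)
    (GRing.Zmodule_isLmodule.Build B _ scA sc1 scDr scDl).
have prL : linear (pr : M -> res N).
  by move=> a u v; rewrite prD -scE.
exists N, (mk_linear prL); split=> [n|m]; first by exists (rep n); exact: prK.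
have pr0 : pr 0 = 0 by have := prB 0 0; rewrite !subrr.
by rewrite -[mk_linear prL m]/(pr m) -[0]/(0 : Q) -pr0 prP subr0.
Qed.

Lemma reduction_universal (M : lmodType A) (N T : lmodType B)
    (pi : {linear M -> res N}) (g : {linear M -> res T}) :
  is_reduction pi ->
  exists h : {linear N -> T}, forall m, h (pi m) = g m.
Proof.
move=> [surjP kerP].
have ker m : pi m = 0 -> g m = 0.
  by move=> /kerP[m' ->]; rewrite linearZ; apply: res_x.
have [h hE] := linear_descend surjP ker.
by exists (mk_linear (res_linear_conv h)).
Qed.

Lemma reduction_projective (P : lmodType A) (N : lmodType B)
    (pi : {linear P -> res N}) :
  is_reduction pi -> projective P -> projective N.
Proof.
move=> redP projP S T u g surjU.
have [h hE] := projP _ _ (mk_linear (res_linear u))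
  (mk_linear (res_linear g) \o pi) surjU.
have [k kE] := reduction_universal h redP.
exists k => n; have [m <-] := redP.1 n.
by rewrite kE; apply: hE.
Qed.

Lemma reduction_map (M M' : lmodType A) (N N' : lmodType B)
    (pi : {linear M -> res N}) (pi' : {linear M' -> res N'})
    (g : {linear M -> M'}) :
  is_reduction pi ->
  exists h : {linear N -> N'}, forall m, h (pi m) = pi' (g m).
Proof. exact: (reduction_universal (pi' \o g)). Qed.

(** Reduction modulo x keeps a short exact sequence 0 -> K -> P -> M -> 0 exact
    when M is torsion-free, because Tor_1(M, B) is then zero. *)
Lemma reduction_pd_le n (M : lmodType A) (N : lmodType B)
    (pi : {linear M -> res N}) :
  is_reduction pi -> torsion_free M -> pd_le n M -> pd_le n N.
Proof.
elim: n M N pi => [|n IHn] M N pi redM tfM.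
  exact: reduction_projective redM.
move=> [K [P [i [e [projP [injI surjE kerE] pdK]]]]].
have tfP := torsion_free_projective projP.
have [NK [piK redK]] := reduction_exists K.
have [NP [piP redP]] := reduction_exists P.
have [i' i'E] := reduction_map piP i redK.
have [e' e'E] := reduction_map pi e redP.
exists NK, NP, i', e'; split; first exact: reduction_projective redP projP.
  split.
  - apply: linear_inj0 => n0; have [k <-] := redK.1 n0.
    rewrite i'E => /redP.2[p pE]; apply/redK.2.
    have /kerE[k' k'E] : e p = 0.
      apply: tfM; rewrite -linearZ -pE.
      by apply/kerE; exists k.
    by exists k'; apply: injI; rewrite linearZ k'E.
  - move=> n0; have [m <-] := redM.1 n0; have [p <-] := surjE m.
    by exists (piP p).
  - move=> n0; split=> [|[k0 <-]].
      have [p <-] := redP.1 n0; rewrite e'E => /redM.2[m mE].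
      have [q qE] := surjE m.
      have /kerE[k kE] : e (p - x *: q) = 0.
        by rewrite linearB linearZ qE mE subrr.
      exists (piK k); rewrite i'E kE linearB [piP (x *: q)]linearZ.
      by rewrite [X in _ - X]res_x subr0.
    have [k <-] := redK.1 k0; rewrite i'E e'E.
    by rewrite (kerE (i k)).2 ?linear0 //; exists k.
exact: IHn redK (torsion_free_inj injI tfP) pdK.
Qed.

(** Let F -> P be a free cover over A. As P is projective over B, it is a
    direct summand of F/xF; let phi be a lift to F of the idempotent that
    projects F/xF onto the kernel of F/xF -> P. Both phi and x map F into the
    kernel K of F -> P, and every k in K differs from phi(k) by a multiple of x,
    which is unique and linear in k as x is regular on F. So
    k |-> (k, (k - phi(k))/x) is a section of (g, g') |-> phi(g) + x g', and K
    is a retract of F * F. *)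
Lemma res_projective (P : lmodType B) : projective P -> pd_le 1 (res P).
Proof.
move=> projP; have [e surjE] := free_cover (res P).
pose F : lmodType A := free_mod A (res P).
have projF : projective F := @free_mod_projective A _.
have tfF := torsion_free_projective projF.
have [N [pi redF]] := reduction_exists F.
have [e' e'E] := reduction_universal e redF.
have surjE' y : exists n, e' n = y.
  by have [p pE] := surjE y; exists (pi p); rewrite e'E.
have [s sE] := projective_section projP surjE'.
have [phi phiE] := projF _ _ pi
  (pi \- (mk_linear (res_linear (s \o e')) \o pi)) redF.1.
exists (ker_mod e), F, (ker_val e), e.
have exE := short_exact_ker surjE; have [injK _ kerE] := exE.
split=> //.
have e0 (g : F) : exists k, ker_val e k = phi g.
  apply/kerE; rewrite -e'E phiE /= linearB /= sE; exact: subrr.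
(* phi' and mx are phi and x with values in K; dv is (k - phi(k))/x. *)
have [phi' phi'E] := linear_factor injK e0.
have xe0 (g : F) : exists k, ker_val e k = mk_linear (@mulx_linear F) g.
  by apply/kerE; rewrite /= linearZ; apply: res_x.
have [mx mxE] := linear_factor injK xe0.
have diff (k : ker_mod e) : exists g, mk_linear (@mulx_linear F) g =
    (ker_val e \- (phi \o ker_val e)) k.
  have /redF.2[g gE] : pi ((ker_val e \- (phi \o ker_val e)) k) = 0.
    rewrite linearB phiE /= opprB addrCA subrr addr0.
    rewrite e'E; have := ker_modP k => /= ->; exact: linear0.
  by exists g.
have injX : injective (mk_linear (@mulx_linear F)) by apply: linear_inj0.
have [dv dvE] := linear_factor injX diff.
apply: (projective_retract (r := mk_linear (linear_comb phi' mx))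
  (s := mk_linear (linear_pair (ker_val e) dv))); last exact: projective_prod.
move=> k; apply: injK; rewrite [mk_linear _ _]/= linearD phi'E mxE.
by rewrite -[dv _]/(dv k) dvE /= addrCA subrr addr0.
Qed.

Lemma res_short_exact (X Y Z : lmodType B) (i : {linear X -> Y})
    (e : {linear Y -> Z}) :
  short_exact i e ->
  short_exact (mk_linear (res_linear i)) (mk_linear (res_linear e)).
Proof. by []. Qed.

Lemma res_pd_le n (M : lmodType B) : pd_le n M -> pd_le n.+1 (res M).
Proof.
elim: n M => [|n IHn] M; first exact: res_projective.
move=> [K [P [i [e [projP ex /IHn pdK]]]]].
apply: (pd_le_cokernel (n := n.+1) (res_short_exact ex) pdK).
exact: pd_le_leq (res_projective projP).
Qed.

(** The map M -> K/xK sends the image of y in P to the class of x y, which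
    lies in K because x kills M; it is the connecting map of the snake lemma for
    multiplication by x. Here t is multiplication by x from P to K and s the
    connecting map. *)
Lemma res_pd_le_descent d n (M : lmodType B) :
  pd_le d M -> pd_le n.+1 (res M) -> pd_le n M.
Proof.
move=> pdM pdRM; elim: d pdM => [|d IHd] pdM.
  exact: pd_le_leq (leq0n n) pdM.
case: (leqP d.+1 n) => [le_d_n|]; first exact: pd_le_leq le_d_n pdM.
rewrite ltnS => le_n_d; apply: IHd.
have [K [P [i [e [projP [injI surjE kerE] pdK]]]]] := pdRM.
have tfP := torsion_free_projective projP.
have [N [piK redK]] := reduction_exists K.
have [NP [piP redP]] := reduction_exists P.
have [i' i'E] := reduction_map piP i redK.
have [e' e'E] := reduction_universal e redP.
have surjE' y : exists n, e' n = y.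
  by have [p pE] := surjE y; exists (piP p); rewrite e'E.
have exL := short_exact_ker surjE'; have [injL _ kerL] := exL.
have projNP := reduction_projective redP projP.
have pdL := pd_le_kernel exL (pd_le_leq (leq0n d) projNP) pdM.
have pdN : pd_le d N.
  apply: pd_le_leq le_n_d _.
  exact: reduction_pd_le redK (torsion_free_inj injI tfP) pdK.
have ei k : e (i k) = 0 by apply/kerE; exists k.
have e'0 n0 : exists l, ker_val e' l = i' n0.
  by apply/kerL; have [k <-] := redK.1 n0; rewrite i'E e'E ei.
have [c cE] := linear_factor injL e'0.
have xP p : exists k, i k = mk_linear (@mulx_linear P) p.
  by apply/kerE; rewrite /= linearZ; apply: res_x.
have [t tE] := linear_factor injI xP.
have {}tE p : i (t p) = x *: p := tE p.
have ti k : t (i k) = x *: k by apply: injI; rewrite tE linearZ.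
have t0 p : e p = 0 -> (piK \o t) p = 0.
  by move=> /kerE[k <-]; rewrite /= ti linearZ; apply: res_x.
have [s sE] := linear_descend surjE t0.
have {}sE p : s (e p) = piK (t p) := sE p.
apply: (pd_le_kernel (i := mk_linear (res_linear_conv s)) (e := c)) pdN _;
  last first.
  exact: pd_leS.
split.
- apply: linear_inj0 => m; have [p <-] := surjE m.
  rewrite [mk_linear _ _]/= sE => /redK.2[k kE]; apply/kerE; exists k.
  apply/eqP; rewrite -subr_eq0; apply/eqP/tfP.
  by rewrite scalerBr -(tE p) kE linearZ subrr.
- move=> l; have [p pE] := redP.1 (ker_val e' l).
  have /kerE[k kE] : e p = 0 by rewrite -e'E pE; exact: (ker_modP l).
  by exists (piK k); apply: injL; rewrite cE i'E kE.
- move=> n0; split=> [cn0|[m <-]].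
    have [k kE] := redK.1 n0; subst n0.
    have := cE (piK k); rewrite cn0 linear0 i'E => /esym/redP.2[p pE].
    exists (e p); rewrite [mk_linear _ _]/= sE; congr (piK _).
    by apply: injI; rewrite tE.
  have [p <-] := surjE m; apply: injL; rewrite linear0 cE [mk_linear _ _]/= sE.
  by rewrite i'E tE linearZ; apply: res_x.
Qed.

End ChangeOfRings.

(** * Multiplication by p on Witt vectors *)

Section MultiplicationByP.
Variables (p : nat) (pP : prime p).

Lemma ghost_mulrn (A : comPzRingType) n k (a : witt pP A) :
  ghost p n (a *+ k) = ghost p n a *+ k.
Proof.
elim: k => [|k IHk]; first exact: ghost_zero.
by rewrite !mulrS -IHk; apply: ghost_add.
Qed.

Lemma witt_mulrn_nat (A S : comPzRingType) (h : {rmorphism A -> S}) k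
    (a : witt pP A) : h \o (a *+ k) = (h \o a : witt pP S) *+ k.
Proof.
elim: k => [|k IHk]; first exact: (witt_zero_nat h).
by rewrite !mulrS -IHk; apply: (witt_add_nat pP h a (a *+ k)).
Qed.

(** Once a_i and b_i agree modulo p for i < n, the terms of index i of the n-th
    ghost components agree modulo p^(n+1), which leaves
    p^n a_n = p^n b_n modulo p^(n+1). *)
Lemma ghost_cong_coef (A : comPzRingType) (a b : nat -> A) :
  (forall (c : A) n, (0 < n)%N -> c *+ n = 0 -> c = 0) ->
  (forall n, cong (p ^ n.+1) (ghost p n a) (ghost p n b)) ->
  forall n, cong p (a n) (b n).
Proof.
move=> tfA ghostE; elim/ltn_ind => n IHn.
have [c cE] := ghostE n; move: cE; rewrite !ghost_recr.
have [d ->] : cong (p ^ n.+1) (\sum_(i < n) a i ^+ (p ^ (n - i)) *+ p ^ i)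
    (\sum_(i < n) b i ^+ (p ^ (n - i)) *+ p ^ i).
  apply: (cong_sum (F := fun i => a i ^+ (p ^ (n - i)) *+ p ^ i)
    (G := fun i => b i ^+ (p ^ (n - i)) *+ p ^ i)) => i lt_i_n.
  have -> : (p ^ n.+1 = p ^ (n - i).+1 * p ^ i)%N.
    by rewrite -expnD addSn subnK // ltnW.
  exact/cong_mulrn/cong_exppX/IHn.
rewrite -!addrA => /addrI E; exists (c - d).
apply/eqP; rewrite -subr_eq0; apply/eqP/(tfA _ _ (pow_gt0 pP n)).
rewrite mulrnBl mulrnDl -mulrnA -expnS mulrnBl.
apply/eqP; rewrite subr_eq0 addrA; apply/eqP/(addrI (d *+ p ^ n.+1)).
by rewrite E addrCA [X in _ = _ + X]addrC addrA addrNK.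
Qed.

(** Verschiebung after the coordinatewise p-th power; the latter is the
    Frobenius of Witt vectors only in characteristic p. *)
Definition witt_VF (R : comPzRingType) (a : nat -> R) (n : nat) : R :=
  if n is m.+1 then a m ^+ p else 0.

(** The two sides differ exactly by p^(n+1) a_n, the last term on the left. *)
Lemma ghost_VF_cong (A : comPzRingType) (a : nat -> A) n :
  cong (p ^ n.+1) (ghost p n a *+ p) (ghost p n (witt_VF a)).
Proof.
case: n => [|n].
  by rewrite !ghost0 /= expn1; exists (a 0%N); rewrite add0r.
rewrite ghost_recr mulrnDl -mulrnA -expnSr.
have -> : ghost p n.+1 (witt_VF a) =
    (\sum_(i < n.+1) a i ^+ (p ^ (n.+1 - i)) *+ p ^ i) *+ p.
  rewrite /ghost big_ord_recl /= expr0n (gtn_eqF (pow_gt0 pP _)) mul0rn add0r.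
  rewrite -sumrMnl; apply: eq_bigr => i _.
  rewrite /bump /= add1n subSS -exprM -expnS -subSn ?leq_ord //.
  by rewrite -mulrnA -expnSr.
by exists (a n.+1).
Qed.

(** Over the integral polynomial ring on the coordinates, p T and VF T have
    ghost components congruent modulo p^(n+1), hence coordinates congruent
    modulo p; the congruence becomes an equality in characteristic p. *)
Lemma witt_mulrp (R : comPzRingType) (a : witt pP R) :
  p%:R = 0 :> R -> a *+ p = witt_VF a.
Proof.
move=> p0; pose T : witt pP (ipoly nat) := @var nat.
have TE n : cong p ((T *+ p) n) (witt_VF T n).
  apply: ghost_cong_coef => [c k|k]; first exact: ipoly_torsion_free.
  by rewrite ghost_mulrn; apply: ghost_VF_cong.
pose ev : {rmorphism ipoly nat -> R} := peval a.
have evT : ev \o T = a by apply: boolp.funext => i; apply: peval_var.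
apply: boolp.funext => n.
have -> : (a *+ p) n = ev ((T *+ p) n).
  by rewrite -[RHS]/((ev \o (T *+ p)) n) witt_mulrn_nat evT.
have [c ->] := TE n; rewrite rmorphD rmorphMn -mulr_natr p0 mulr0 addr0.
by case: n => [|n]; rewrite /= ?rmorph0 // rmorphXn -[in RHS]evT.
Qed.

Section Perfect.
Variable R : comPzRingType.
Hypothesis Rperf : perfect_Fp_algebra p R.

Lemma witt_proj_surj (r : R) : exists a : witt pP R, witt_proj a = r.
Proof. by exists (fun=> r). Qed.

Lemma witt_natE (a : witt pP R) : p%:R * a = witt_VF a.
Proof. by rewrite mulr_natl witt_mulrp //; case: Rperf. Qed.

Lemma witt_proj_ker (a : witt pP R) :
  witt_proj a = 0 <-> exists b, a = p%:R * b.
Proof.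
have [_ [root rootK Kroot]] := Rperf.
split=> [a0|[b ->]]; last by rewrite witt_natE.
exists (fun n => root (a n.+1)); rewrite witt_natE; apply: boolp.funext.
by case=> [//|n]; rewrite /= Kroot.
Qed.

Lemma witt_p_regular (a : witt pP R) : p%:R * a = 0 -> a = 0.
Proof.
have [_ /bij_inj frobI] := Rperf.
rewrite witt_natE => VF0; apply: boolp.funext => n; apply: frobI.
rewrite expr0n (gtn_eqF (prime_gt0 pP)).
exact: (congr1 (fun u : nat -> R => u n.+1) VF0).
Qed.

End Perfect.
End MultiplicationByP.

Theorem mainTheorem9 (p : nat) (pP : prime p) (R : comPzRingType)
  (Rperf : perfect_Fp_algebra p R) (Q : lmodType R)
  (Qfin : (pdim Q < +oo)%E) :
  (pdim (restr_scalars (@witt_proj p pP R) Q : lmodType (witt pP R)) =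
   pdim Q + 1%:E)%E.
Proof.
have surjW := @witt_proj_surj p pP R.
have kerW (a : witt pP R) := witt_proj_ker Rperf a.
have regW (a : witt pP R) := witt_p_regular Rperf (a := a).
have up n : has_resolution Q n ->
    has_resolution
      (restr_scalars (@witt_proj p pP R) Q : lmodType (witt pP R)) n.+1.
  by rewrite !has_resolutionE; apply: res_pd_le surjW kerW regW n Q.
move: Qfin; rewrite /pdim; case: boolp.pselect => [Q0|Qn0].
  by case: boolp.pselect.
case: boolp.pselect => [ex_d|//] _ /=.
case: boolp.pselect => [ex_m|[]]; last first.
  by have [d /up] := ex_d; exists d.+1.
case: ex_minnP => m resW minW; case: ex_minnP => d resQ minQ.
suff -> : m = d.+1 by rewrite -EFinD addrC -intS.
apply/eqP; rewrite eqn_leq minW ?up //=.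
case: m resW {minW} => [|m] /has_resolutionE pdW.
  case: Qn0 => y; apply: (torsion_free_projective regW pdW).
  exact: (res_x kerW).
rewrite ltnS; apply: minQ; apply/has_resolutionE.
apply: (res_pd_le_descent surjW kerW regW) pdW.
exact/has_resolutionE/resQ.
Qed.
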